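(* For $\ell=1,2$ the monic Sobolev-type Meixner polynomial $\mathcal M^{j,\ell}_n(x;\beta,c;\lambda)$ has the hypergeometric representation $$\mathcal M^{j,\ell}_n(x;\beta,c;\lambda)=\frac{(\beta)_{n-1}c^{n-1}}{(c-1)^{n-1}}\,h_n^{\ell}(x)\;{}_3F_2\!\left(\begin{array}{c}-n,\,-x,\,-f_n^{\ell}(x)\\ \beta,\,-f_n^{\ell}(x)-1\end{array};1-\frac1c\right),$$ where $$f_n^{\ell}(x)=n-1-\frac{n\,c\,(\beta+n-1)A_{1,n}^{j,\ell}(x)}{(1-c)B_{1,n}^{j,\ell}(x)},\qquad h_n^{\ell}(x)=\frac{c(\beta+n-1)}{1-c}A_{1,n}^{j,\ell}(x)-B_{1,n}^{j,\ell}(x).$$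
   Context: Parameters: $\beta,c$ are complex numbers with $c\neq0,1$ and $\beta$ not a negative integer; $\lambda\in\mathbb R_+$, $\alpha\le0$, $j\in\mathbb N=\{1,2,3,\dots\}$, $n\ge1$. Notation: $(a)_k=a(a+1)\cdots(a+k-1)$, $(a)_0=1$; $\Delta f(x)=f(x+1)-f(x)$, $\nabla f(x)=f(x)-f(x-1)$, zeroth powers being the identity. The hypergeometric series is ${}_rF_s(a_1,\dots,a_r;b_1,\dots,b_s;z)=\sum_{k\ge0}\frac{(a_1)_k\cdots(a_r)_k}{(b_1)_k\cdots(b_s)_k}\frac{z^k}{k!}$, where the parameters must be such that the denominator factors in the terms of the series are never zero. The monic Meixner polynomials are $M_n(x;\beta,c)=\frac{c^n\,n!}{(1-c)^n}\sum_{i=0}^n c^{-i}\binom{x}{i}\binom{-x-\beta}{n-i}$. The Meixner functional $\mathbf u$ is the linear functional on polynomials with respect to which they are orthogonal, with $d_n^2:=\langle\mathbf u,M_n^2\rangle=\frac{(\beta)_nc^nn!}{(1-c)^{\beta+2n}}$; when $\beta>0$ and $0<c<1$ it is $\langle \mathbf u,f\rangle=\sum_{x=0}^\infty\frac{(\beta)_x}{x!}c^xf(x)$. Let $\mathcal T=\nabla$ if $\ell=1$ and $\mathcal T=\Delta$ if $\ell=2$. The Sobolev-type Meixner polynomials $\mathcal M^{j,\ell}_n(x;\beta,c;\lambda)$, $n\ge0$, are the monic polynomials ($\deg=n$) orthogonal with respect to $$\langle f,g\rangle_{\lambda,j,\ell}=\langle\mathbf u,fg\rangle+\lambda\,\mathcal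 T^jf(\alpha)\,\mathcal T^jg(\alpha).$$ Let $\mathcal K_{n,\ell}^{(j,j)}(\alpha,\alpha)=\sum_{k=0}^{n-1}\frac{(\mathcal T^jM_k(\alpha;\beta,c))^2}{d_k^2}$ and $$\kappa_n=\frac{\lambda\,\mathcal T^jM_n(\alpha;\beta,c)}{1+\lambda\mathcal K_{n,\ell}^{(j,j)}(\alpha,\alpha)}\cdot\frac{j!}{d_{n-1}^2}.$$ Let $\pi_k^{1}(x)=(x-\alpha+k)_{j+1-k}$ and $\pi_k^{2}(x)=(x-\alpha-j)_{j+1-k}$. Then $$A_{1,n}^{j,\ell}(x)=1-\kappa_n\sum_{k=0}^j\frac{\mathcal T^kM_{n-1}(\alpha;\beta,c)}{k!\,\pi_k^{\ell}(x)},\qquad B_{1,n}^{j,\ell}(x)=\kappa_n\sum_{k=0}^j\frac{\mathcal T^kM_n(\alpha;\beta,c)}{k!\,\pi_k^{\ell}(x)}.$$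
   Formalization: The printed identity is off by a global sign (for β=1, c=1/2, α=0, λ=2, j=n=1, ℓ=2, x=3 it gives −2 instead of 2); the formal theorem puts a factor −1 in front of the right-hand side, with all displayed quotients assumed defined. *)

(* Defs.v *)
From HB Require Import structures.
From mathcomp Require Import all_boot all_order all_algebra.
From mathcomp Require Import complex.
From mathcomp Require Import all_classical all_reals all_analysis.

Set Implicit Arguments.
Unset Strict Implicit.
Unset Printing Implicit Defensive.

Import Order.TTheory GRing.Theory Num.Theory.
Import numFieldNormedType.Exports.

Local Open Scope classical_set_scope.
Local Open Scope complex_scope.
Local Open Scope ring_scope.

Section ComplexPower.
Variable R : realType.
Implicit Types z w : R[i].

(* Real-valued modulus; the ring norm `|z| of R[i] takes its values in R[i]. *)
Definition cmod z : R := Num.sqrt (complex.Re z ^+ 2 + complex.Im z ^+ 2).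

(* Principal argument, with values in ]-pi, pi] for z != 0. *)
Definition carg z : R :=
  let t := acos (complex.Re z / cmod z) in
  if 0 <= complex.Im z then t else - t.

Definition cexp z : R[i] :=
  (expR (complex.Re z) * cos (complex.Im z)) +i*
  (expR (complex.Re z) * sin (complex.Im z)).

Definition clog z : R[i] := ln (cmod z) +i* carg z.

(* Principal branch of z ^ w, meaningful for z != 0. *)
Definition cpow z w : R[i] := cexp (w * clog z).

End ComplexPower.

Section Hypergeometric.
Variable K : numFieldType.
Implicit Types a z : K.

Definition poch a k : K := \prod_(0 <= i < k) (a + i%:R).

Definition pFq_term (s t : seq K) z (k : nat) : K :=
  (\prod_(a <- s) poch a k) / (\prod_(b <- t) poch b k) * (z ^+ k / k`!%:R).

Definition pFq (s t : seq K) z : K^o :=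
  limn (series (fun k => pFq_term s t z k : K^o)).

Definition pFq_defined (t : seq K) : Prop :=
  forall b k, b \in t -> poch b k != 0.

End Hypergeometric.

Section Meixner.
Variable R : realType.
Local Notation C := (R[i]).
Implicit Types (beta c alpha lambda x : C) (j l n k : nat).

(* The generalized binomial coefficient p (p - 1) ... (p - k + 1) / k! of a
   polynomial p. *)
Definition binomp (p : {poly C}) k : {poly C} :=
  (k`!%:R)^-1 *: \prod_(0 <= i < k) (p - i%:R%:P).

Definition meixner beta c n : {poly C} :=
  (c ^+ n * n`!%:R / (1 - c) ^+ n) *:
    \sum_(0 <= i < n.+1)
      c ^- i *: (binomp 'X i * binomp (- 'X - beta%:P) (n - i)).

Definition meixner_norm2 beta c n : C :=
  poch beta n * c ^+ n * n`!%:R / cpow (1 - c) (beta + (2 * n)%:R).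

(* u is unique, since the monic Meixner polynomials form a basis. *)
Definition meixner_functional beta c (u : {scalar {poly C}}) : Prop :=
  forall m n, u (meixner beta c m * meixner beta c n) =
              if m == n then meixner_norm2 beta c n else 0.

Definition fdelta (f : C -> C) : C -> C := fun x => f (x + 1) - f x.
Definition fnabla (f : C -> C) : C -> C := fun x => f x - f (x - 1).

(* l = 1 selects nabla; the only other value in use is l = 2. *)
Definition Tdiff l : (C -> C) -> C -> C := if l == 1%N then fnabla else fdelta.

Definition Tpow l k (p : {poly C}) x : C := iter k (Tdiff l) (horner p) x.

Definition sobolev_form (u : {scalar {poly C}}) lambda alpha j l
    (f g : {poly C}) : C :=
  u (f * g) + lambda * (Tpow l j f alpha * Tpow l j g alpha).

Definition monic_orthogonal (form : {poly C} -> {poly C} -> C)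
    (S : nat -> {poly C}) : Prop :=
  [/\ forall n, S n \is monic,
      forall n, size (S n) = n.+1 &
      forall m n, m != n -> form (S m) (S n) = 0].

Definition kernel_jj beta c alpha j l n : C :=
  \sum_(0 <= k < n)
    Tpow l j (meixner beta c k) alpha ^+ 2 / meixner_norm2 beta c k.

Definition kappa beta c alpha lambda j l n : C :=
  lambda * Tpow l j (meixner beta c n) alpha /
    (1 + lambda * kernel_jj beta c alpha j l n) *
  (j`!%:R / meixner_norm2 beta c n.-1).

Definition pi_fac alpha j l k x : C :=
  if l == 1%N then poch (x - alpha + k%:R) (j.+1 - k)
  else poch (x - alpha - j%:R) (j.+1 - k).

Definition A1 beta c alpha lambda j l n x : C :=
  1 - kappa beta c alpha lambda j l n *
    \sum_(0 <= k < j.+1)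
      Tpow l k (meixner beta c n.-1) alpha / (k`!%:R * pi_fac alpha j l k x).

Definition B1 beta c alpha lambda j l n x : C :=
  kappa beta c alpha lambda j l n *
    \sum_(0 <= k < j.+1)
      Tpow l k (meixner beta c n) alpha / (k`!%:R * pi_fac alpha j l k x).

Definition f_coef beta c alpha lambda j l n x : C :=
  n%:R - 1 -
    n%:R * c * (beta + n%:R - 1) * A1 beta c alpha lambda j l n x /
    ((1 - c) * B1 beta c alpha lambda j l n x).

(* Pitfall: this is the opposite of the coefficient of the connection formula.
   From S_n = A1 M_n + B1 M_(n-1), where
     M_n = (beta)_n (c / (c - 1))^n 2F1(-n, -x; beta; 1 - 1/c),
   the constant term of the series is (beta)_(n-1) (c / (c - 1))^(n-1) times
   c (beta + n - 1) / (c - 1) A1 + B1 = - h_coef, so a factor -1 is needed in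
   front of h_coef in the hypergeometric representation of S_n. *)
Definition h_coef beta c alpha lambda j l n x : C :=
  c * (beta + n%:R - 1) / (1 - c) * A1 beta c alpha lambda j l n x
  - B1 beta c alpha lambda j l n x.

End Meixner.

(* Main.v *)
Require Import Defs.
From HB Require Import structures.
From mathcomp Require Import all_boot all_order all_algebra.
From mathcomp Require Import complex.
From mathcomp Require Import all_classical all_reals all_analysis.
From mathcomp Require Import ring.

Set Implicit Arguments.
Unset Strict Implicit.
Unset Printing Implicit Defensive.

Import Order.TTheory GRing.Theory Num.Theory.
Import numFieldNormedType.Exports.

Local Open Scope complex_scope.
Local Open Scope ring_scope.

(** Three facts combine. Expanding [c ^- i = (1 - (1 - c^-1)) ^+ i] in the
    definition of the Meixner polynomials and summing by Chu-Vandermonde gives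
    [M_n = (beta)_n (c / (c - 1))^n 2F1(-n, -x; beta; 1 - 1/c)]
    ([meixnerE], [meixner_hypergeometric]); it also shows that [M_n] is monic of
    degree [n], so that the [M_n] form a sequence of orthogonal polynomials,
    whose norms do not vanish because every [(beta)_k] is nonzero.

    Next, orthogonality of [S_n] to all polynomials of lower degree gives
    [S_n = M_n - lambda (T^j S_n)(alpha) T^j_y K_n(x, y)] at [y = alpha]
    ([sobolev_kernel]). Applying [T^j] at [alpha] determines the unknown
    [T^j S_n]; Christoffel-Darboux writes [(x - y) K_n(x, y)] in terms of [M_n]
    and [M_(n-1)], and the differences of a quotient by [x - y] have the closed
    form [Tpow_div_linear]. Hence [S_n = A M_n + B M_(n-1)]
    ([sobolev_connection]).

    Finally, the terminating series of [M_n] and [M_(n-1)] are combined term by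
    term: [(-(n-1))_k = (-n)_k (n - k) / n], so [S_n] is the series of [M_n]
    with its [k]-th term multiplied by an affine function of [k], proportional
    to [f + 1 - k]. Since [(-f)_k / (-f - 1)_k = (f + 1 - k) / (f + 1)], this
    affine factor is what turns the 2F1 into the 3F2. *)

(** * Pochhammer symbols and terminating hypergeometric series *)

Section Pochhammer.
Variable K : numFieldType.
Implicit Types (a z : K) (s t : seq K).

Lemma poch0 a : poch a 0 = 1.
Proof. by rewrite /poch big_geq. Qed.

Lemma pochSr a k : poch a k.+1 = poch a k * (a + k%:R).
Proof. by rewrite /poch big_nat_recr. Qed.

Lemma pochSl a k : poch a k.+1 = a * poch (a + 1) k.
Proof.
rewrite /poch big_nat_recl // addr0; congr (_ * _).
by apply: eq_bigr => i _; rewrite -addrA -natr1 (addrC 1).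
Qed.

Lemma poch_shift a k : a * poch (a + 1) k = poch a k * (a + k%:R).
Proof. by rewrite -pochSl pochSr. Qed.

Lemma pochD a m n : poch a (m + n) = poch a m * poch (a + m%:R) n.
Proof.
elim: n => [|n IH]; first by rewrite addn0 poch0 mulr1.
by rewrite addnS !pochSr IH mulrA natrD addrA.
Qed.

Lemma poch_oppn_eq0 n k : (n < k)%N -> poch (- n%:R : K) k = 0.
Proof.
move=> ltnk; rewrite -(subnKC ltnk) pochD pochSr addNr.
by rewrite mulr0 mul0r.
Qed.

Lemma poch_oppn n k :
  (k <= n)%N -> poch (- n%:R : K) k * (n - k)`!%:R = (- 1) ^+ k * n`!%:R.
Proof.
elim: k => [|k IH] lekn; first by rewrite poch0 subn0 expr0.
rewrite pochSr exprS -[RHS]mulrA -IH ?(ltnW lekn)//.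
rewrite -(subnSK lekn) factS natrM subnSK // natrB ?(ltnW lekn)//.
ring.
Qed.

Lemma pFq_term_eq0 s t z n k :
  - n%:R \in s -> (n < k)%N -> pFq_term s t z k = 0.
Proof.
move=> sn ltnk; rewrite /pFq_term.
suff -> : \prod_(a <- s) poch a k = 0 by rewrite !mul0r.
by rewrite (big_rem _ sn) /= poch_oppn_eq0 // mul0r.
Qed.

Lemma pFq_terminating s t z n N :
  - n%:R \in s -> (n < N)%N ->
  pFq s t z = \sum_(0 <= k < N) pFq_term s t z k.
Proof.
move=> sn ltnN; rewrite /pFq; apply: cvg_lim => //.
apply: cvg_near_cst; near=> M.
have leNM : (N <= M)%N by near: M; exact: nbhs_infty_ge.
rewrite /series /= (@big_cat_nat _ _ _ N) //= -[RHS]addr0; congr (_ + _).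
rewrite big_nat_cond big1 //.
move=> k /andP[/andP[leNk _] _]; apply: (pFq_term_eq0 _ _ sn).
exact: leq_trans leNk.
Unshelve. all: end_near. Qed.

End Pochhammer.

(** * Orthogonal polynomials *)

Lemma size_sub_monic (F : fieldType) n (p q : {poly F}) :
  size p = n.+1 -> size q = n.+1 -> p \is monic -> q \is monic ->
  (size (p - q)%R <= n)%N.
Proof.
move=> sp sq /monicP mp /monicP mq; apply/leq_sizeP => i.
rewrite leq_eqVlt coefB => /predU1P[<-|ltni].
  by move: mp mq; rewrite /lead_coef sp sq /= => -> ->; rewrite subrr.
by rewrite !nth_default ?subrr // ?sp ?sq.
Qed.

Section GradedBasis.
Variables (F : fieldType) (P : nat -> {poly F}).
Hypothesis P_monic : forall n, P n \is monic.
Hypothesis P_size : forall n, size (P n) = n.+1.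

(** A linear map that vanishes on the first [n] elements of a graded monic basis
    vanishes on all polynomials of degree less than [n]. *)
Lemma graded_basis_eq0 (V : lmodType F) (L : {poly F} -> V) n :
  (forall a p q, L (a *: p + q) = a *: L p + L q) ->
  (forall k, (k < n)%N -> L (P k) = 0) ->
  forall p : {poly F}, (size p <= n)%N -> L p = 0.
Proof.
move=> Llin; elim: n => [|n IH] LP0 p sp.
  have L0 : L 0 = 0.
    by have := Llin (- 1) 0 0; rewrite scaler0 addr0 scaleN1r addNr.
  by move: sp; rewrite leqn0 size_poly_eq0 => /eqP ->.
rewrite -[p](subrK (p`_n *: P n)) addrC Llin LP0 // scaler0 add0r.
have LPn0 k : (k < n)%N -> L (P k) = 0 by move=> ltkn; apply: LP0; apply: leqW.
apply: (IH LPn0).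
apply/leq_sizeP => i; rewrite leq_eqVlt coefB coefZ => /predU1P[<-|ltni].
  have /monicP := P_monic n; rewrite /lead_coef P_size /= => ->.
  by rewrite mulr1 subrr.
have pi0 : p`_i = 0 by apply: nth_default; apply: leq_trans ltni.
by rewrite pi0 (@nth_default _ _ (P n)) ?mulr0 ?subrr // P_size.
Qed.

End GradedBasis.

Section Orthogonal.
Variables (F : fieldType) (P : nat -> {poly F}) (d : nat -> F).
Variable u : {scalar {poly F}}.
Hypothesis P_monic : forall n, P n \is monic.
Hypothesis P_size : forall n, size (P n) = n.+1.
Hypothesis d_neq0 : forall n, d n != 0.
Hypothesis P_orth : forall m n, u (P m * P n) = if m == n then d n else 0.

Lemma orthogonal_expansion n (p : {poly F}) :
  (size p <= n)%N -> p = \sum_(0 <= k < n) (u (p * P k) / d k) *: P k.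
Proof.
pose L p : {poly F} := p - \sum_(0 <= k < n) (u (p * P k) / d k) *: P k.
move=> sp; apply/eqP; rewrite -subr_eq0; apply/eqP; rewrite -/(L p).
apply: (graded_basis_eq0 P_monic P_size (n := n)) (sp) => [a q r|k ltkn].
  rewrite /L scalerBr scaler_sumr addrACA -opprD -big_split /=; congr (_ - _).
  apply: eq_bigr => k _.
  by rewrite mulrDl -scalerAl linearP /= mulrDl scalerDl scalerA mulrA.
rewrite /L big_mkord (bigD1 (Ordinal ltkn)) //= P_orth eqxx divff // scale1r.
rewrite big1 ?addr0 ?subrr // => i neik; rewrite P_orth ifN ?mul0r ?scale0r //.
by apply: contraNneq neik => eki; apply/eqP/val_inj.
Qed.

Lemma orthogonal_low n (p : {poly F}) : (size p <= n)%N -> u (p * P n) = 0.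
Proof.
move=> sp; apply: (@graded_basis_eq0 F P P_monic P_size F^o
  (fun p => u (p * P n)) n) (sp) => [a q r|k ltkn].
  by rewrite mulrDl -scalerAl linearP.
by rewrite P_orth ltn_eqF.
Qed.

(** The reproducing kernel of the polynomials of degree less than [n], as a
    polynomial in its second variable. *)
Definition kernel n x : {poly F} := \sum_(0 <= k < n) ((P k).[x] / d k) *: P k.

Lemma size_kernel n x : (size (kernel n x) <= n)%N.
Proof.
rewrite /kernel big_mkord; apply: (leq_trans (size_sum _ _ _)).
apply/bigmax_leqP => i _; apply: (leq_trans (size_scale_leq _ _)).
by rewrite P_size.
Qed.

Lemma kernel_reproducing n x (p : {poly F}) : (size p <= n)%N -> u (kernel n x * p) = p.[x].
Proof.
move=> sp; rewrite {2}(orthogonal_expansion sp) horner_sum mulr_suml linear_sum.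
apply: eq_bigr => k _ /=; rewrite -scalerAl linearZ /= hornerZ (mulrC p).
ring.
Qed.

(** Both sides have degree at most [n] in the second variable; subtracting the
    term in [P n] leaves degree less than [n], so that the remaining equality
    can be tested against [P k] for [k < n], where the reproducing property
    evaluates everything. *)
Lemma Christoffel_Darboux n x :
  (x%:P - 'X) * kernel n.+1 x =
  (d n)^-1 *: ((P n.+1).[x] *: P n - (P n).[x] *: P n.+1).
Proof.
pose t := (P n).[x] / d n.
set lhs := (_ * _).
have sXP : (size (P n.+1 - 'X * P n)%R <= n.+1)%N.
  apply: size_sub_monic; rewrite ?P_size ?monicMl ?monicX //.
  by rewrite mulrC size_mulX ?P_size // -size_poly_eq0 P_size.
have slhs : (size (lhs + t *: P n.+1)%R <= n.+1)%N.
  have -> : lhs + t *: P n.+1 = (x%:P - 'X) * kernel n x +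
              t *: (x *: P n + (P n.+1 - 'X * P n)).
    rewrite /lhs /kernel big_nat_recr //= -/t -!mul_polyC.
    ring.
  rewrite (leq_trans (size_polyD _ _)) // geq_max; apply/andP; split.
    rewrite (leq_trans (size_polyMleq _ _)) //.
    by rewrite -opprB size_polyN size_XsubC addSn add1n /= ltnS size_kernel.
  rewrite (leq_trans (size_scale_leq _ _)) // (leq_trans (size_polyD _ _)) //.
  by rewrite geq_max sXP andbT (leq_trans (size_scale_leq _ _)) // P_size.
have uXP k : u (lhs * P k) = u (kernel n.+1 x * (x *: P k - 'X * P k)).
  by congr (u _); rewrite /lhs -mul_polyC; ring.
suff E : lhs + t *: P n.+1 = ((P n.+1).[x] / d n) *: P n.
  rewrite -[lhs](addrK (t *: P n.+1)) E scalerBr !scalerA /t.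
  by congr (_ *: _ - _ *: _); rewrite mulrC.
rewrite (orthogonal_expansion slhs) big_nat_recr //= big_nat_cond big1 ?add0r.
  congr (_ *: _); congr (_ / _).
  rewrite mulrDl linearD /= -scalerAl linearZ /= P_orth eqn_leq ltnn mulr0 addr0.
  have -> : u (lhs * P n) = u (kernel n.+1 x *
     ((x *: P n + (P n.+1 - 'X * P n)) - P n.+1)).
    by rewrite uXP; congr (u _); ring.
  rewrite mulrBr linearB /= orthogonal_low ?size_kernel // subr0.
  rewrite kernel_reproducing; last first.
    rewrite (leq_trans (size_polyD _ _)) // geq_max sXP andbT.
    by rewrite (leq_trans (size_scale_leq _ _)) // P_size.
  by rewrite !hornerE /=; ring.
move=> k /andP[ltkn _]; rewrite mulrDl linearD /= -scalerAl linearZ /= P_orth.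
rewrite gtn_eqF ?mulr0 ?addr0; last exact: leqW.
rewrite uXP kernel_reproducing ?hornerE ?subrr ?mul0r ?scale0r //.
rewrite (leq_trans (size_polyD _ _)) // geq_max size_polyN.
rewrite (leq_trans (size_scale_leq _ _)) ?P_size ?(leqW ltkn) //=.
by rewrite mulrC size_mulX ?P_size // -size_poly_eq0 P_size.
Qed.

End Orthogonal.

(** * Powers of difference operators *)

Section Differences.
Variable R : realType.
Local Notation C := R[i].
Implicit Types (a x y alpha : C) (p q : {poly C}) (j l k : nat).

Lemma Tpow_linear l k a p q x :
  Tpow l k (a *: p + q) x = a * Tpow l k p x + Tpow l k q x.
Proof.
rewrite /Tpow; elim: k x => [|k IH] x /=; first by rewrite !hornerE.
by rewrite /Tdiff; case: ifP => l1; rewrite /fnabla /fdelta /= /Tdiff l1 in IH *;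
   rewrite !IH; ring.
Qed.

Lemma Tpow_zero l k x : Tpow l k 0 x = 0.
Proof.
by have := Tpow_linear l k (- 1) 0 0 x; rewrite scaler0 addr0 mulN1r addNr.
Qed.

Lemma Tpow_sum l k n (a : nat -> C) (p : nat -> {poly C}) x :
  Tpow l k (\sum_(0 <= i < n) a i *: p i) x =
  \sum_(0 <= i < n) a i * Tpow l k (p i) x.
Proof.
elim: n => [|n IH]; first by rewrite !big_geq // Tpow_zero.
by rewrite !big_nat_recr //= addrC Tpow_linear IH addrC.
Qed.

(** The sign of the step of [Tdiff l]: [1] for the backward difference and [-1]
    for the forward one, so that [Tdiff l] compares the values at [x] and
    [x - Tshift l]. It lets both operators be treated by one formula. *)
Definition Tshift l : C := if l == 1%N then 1 else - 1.

(** The Leibniz rule for the product with a polynomial of degree one. *)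
Lemma Tpow_mul_linear l k p x y :
  Tpow l k.+1 ((x%:P - 'X) * p) y =
  (x - y + Tshift l * k.+1%:R) * Tpow l k.+1 p y - k.+1%:R * Tpow l k p y.
Proof.
rewrite /Tpow /Tshift; elim: k y => [|k IH] y.
  by rewrite /= /Tdiff; case: ifP => _; rewrite /fnabla /fdelta !hornerE; ring.
rewrite !(iterS k.+1).
move: IH; set f := iter k.+1 _ _; rewrite (iterS k).
set g := iter k _ _; rewrite /Tdiff => IH.
case: ifP IH => _ IH; rewrite /fnabla /fdelta !IH /fnabla /fdelta -[k.+2%:R]natr1;
  ring.
Qed.

Lemma pi_facS alpha j l k x :
  (k <= j)%N -> pi_fac alpha j.+1 l k x =
  (x - alpha + Tshift l * j.+1%:R) * pi_fac alpha j l k x.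
Proof.
move=> lekj; rewrite /pi_fac /Tshift; case: ifP => _.
  rewrite (subSn (leqW lekj)) pochSr mulrC natrB ?leqW // mul1r; congr (_ * _).
  ring.
rewrite (subSn (leqW lekj)) pochSl; congr (_ * poch _ _).
  by ring.
by rewrite -natr1; ring.
Qed.

Lemma pi_fac_diag alpha j l x :
  pi_fac alpha j l j x = x - alpha + Tshift l * j%:R.
Proof.
rewrite /pi_fac /Tshift subSnn /poch !big_nat1.
by case: ifP => _; ring.
Qed.

(** The iterated difference at [alpha] of the quotient [p = q / (x - 'X)], by
    solving the recursion [Tpow_mul_linear] for the differences of [p]. *)
Lemma Tpow_div_linear alpha j l x p q :
  (x%:P - 'X) * p = q ->
  (forall k, (k <= j)%N -> pi_fac alpha j l k x != 0) ->
  Tpow l j p alpha =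
  j`!%:R * \sum_(0 <= k < j.+1)
             Tpow l k q alpha / (k`!%:R * pi_fac alpha j l k x).
Proof.
move=> <-{q}; elim: j => [|j IH] pi0.
  rewrite big_nat1 fact0 !mul1r /Tpow /= !hornerE.
  have := pi0 0%N (leqnn _); rewrite pi_fac_diag mulr0 addr0 => ?.
  by rewrite mulrAC divff // mul1r.
have := pi0 j.+1 (leqnn _); rewrite pi_fac_diag => piS0.
have pij0 k : (k <= j)%N -> pi_fac alpha j l k x != 0.
  by move=> lekj; have := pi0 k (leqW lekj); rewrite pi_facS // mulf_eq0 negb_or
    => /andP[].
rewrite big_nat_recr // pi_fac_diag Tpow_mul_linear.
set s := x - alpha + _ in piS0 *.
under eq_big_nat => k /andP[_ lekj] do
  rewrite pi_facS // -/s mulrCA invfM mulrCA.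
rewrite -mulr_sumr IH // factS natrM; move: (\sum_(_ <= _ < _) _) => sm.
have f0 : (j`!%:R : C) != 0 by rewrite pnatr_eq0 -lt0n fact_gt0.
have j0 : (j.+1%:R : C) != 0 by rewrite pnatr_eq0.
move: (Tpow l j.+1 p alpha) => Tp /=.
by field; rewrite f0 piS0 (addrC 1) natr1.
Qed.

End Differences.

(** * Meixner polynomials *)

Section MeixnerPolynomials.
Variable R : realType.
Local Notation C := R[i].
Implicit Types (a c beta x : C) (p q : {poly C}) (k n : nat).

Lemma natf_neq0 n : (n.+1%:R : C) != 0.
Proof. by rewrite pnatr_eq0. Qed.

Lemma factf_neq0 n : (n`!%:R : C) != 0.
Proof. by rewrite pnatr_eq0 -lt0n fact_gt0. Qed.

Lemma binomp0 p : binomp p 0 = 1.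
Proof. by rewrite /binomp big_geq // fact0 invr1 scale1r. Qed.

Lemma binompS p k : k.+1%:R *: binomp p k.+1 = binomp p k * (p - k%:R%:P).
Proof.
rewrite /binomp big_nat_recr //= scalerA -scalerAl factS natrM invfM.
by rewrite mulrA divff ?natf_neq0 // mul1r.
Qed.

(** Chu-Vandermonde. *)
Lemma binompD p q n :
  \sum_(0 <= i < n.+1) binomp p i * binomp q (n - i) = binomp (p + q) n.
Proof.
elim: n => [|n IH]; first by rewrite big_nat1 !binomp0 mulr1.
apply: (@scalerI _ _ n.+1%:R); first exact: natf_neq0.
rewrite binompS -IH mulr_suml scaler_sumr.
(* n + 1 = i + (n + 1 - i) *)
transitivity (\sum_(0 <= i < n.+2) (i%:R *: binomp p i) * binomp q (n.+1 - i) +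
  \sum_(0 <= i < n.+2) binomp p i * ((n.+1 - i)%:R *: binomp q (n.+1 - i))).
  rewrite -big_split /=; apply: eq_big_nat => i /andP[_ lein].
  rewrite -(scalerAl i%:R) -(scalerAr (n.+1 - i)%:R) -scalerDl -natrD subnKC //.
rewrite big_nat_recl // scale0r mul0r add0r.
rewrite [X in _ + X]big_nat_recr //= subnn scale0r mulr0 addr0 -big_split /=.
apply: eq_big_nat => i /andP[_ lein]; rewrite subSS binompS subSn // binompS.
rewrite natrB // polyCB; ring.
Qed.

Lemma binomp_mul_bin p k m :
  'C(k + m, k)%:R *: binomp p (k + m) = binomp p k * binomp (p - k%:R%:P) m.
Proof.
have f0 := factf_neq0.
have E : \prod_(k <= i < k + m) (p - i%:R%:P) =
         \prod_(0 <= i < m) (p - k%:R%:P - i%:R%:P).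
  rewrite -{1}[k]add0n big_addn addKn; apply: eq_bigr => i _.
  by rewrite -addrA -opprD -polyCD -natrD addnC.
rewrite /binomp (@big_cat_nat _ _ _ k) ?leq_addr //= E.
rewrite -scalerAl -scalerAr !scalerA; congr (_ *: _).
have /(congr1 (fun n => n%:R : C)) := bin_fact (leq_addr m k).
rewrite addKn !natrM => <-.
have b0 : ('C(k + m, k)%:R : C) != 0 by rewrite pnatr_eq0 -lt0n bin_gt0 leq_addr.
by field; rewrite b0 !f0.
Qed.

Lemma binompC a n : binomp (- a%:P) n = ((- 1) ^+ n * poch a n / n`!%:R)%:P.
Proof.
elim: n => [|n IH]; first by rewrite binomp0 poch0 fact0 expr0 mul1r divr1.
apply: (@scalerI _ _ n.+1%:R); first exact: natf_neq0.
rewrite binompS IH -mul_polyC -!polyCN -polyCD -!polyCM; congr (_%:P).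
rewrite pochSr factS natrM exprS.
have f0 := factf_neq0 n; have n0 := natf_neq0 n.
by field; rewrite f0 (addrC 1) natr1.
Qed.

(** The Meixner polynomials in the basis of the binomial polynomials. *)
Lemma meixnerE beta c n : c != 0 ->
  meixner beta c n = (c ^+ n * n`!%:R / (c - 1) ^+ n) *:
    \sum_(0 <= k < n.+1)
      ((1 - c^-1) ^+ k * (poch (beta + k%:R) (n - k) / (n - k)`!%:R)) *:
        binomp 'X k.
Proof.
move=> c0; rewrite /meixner.
have sgn : c ^+ n * n`!%:R / (1 - c) ^+ n =
           (c ^+ n * n`!%:R / (c - 1) ^+ n) * (- 1) ^+ n.
  by rewrite -[1 - c]opprB (exprNn (c - 1)) invfM invr_sign; ring.
rewrite sgn -scalerA; congr (_ *: _); set w := 1 - c^-1.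
(* the binomial formula for c ^- i = (1 - w) ^+ i *)
have cE i : (i < n.+1)%N ->
    c ^- i = \sum_(0 <= k < n.+1) (- w) ^+ k * 'C(i, k)%:R.
  move=> lein; rewrite -exprVn (_ : c^-1 = 1 + - w); last by rewrite /w; ring.
  rewrite exprDn -(big_mkord xpredT (fun k => 1 ^+ (i - k) * (- w) ^+ k *+ 'C(i, k))).
  rewrite [RHS](@big_cat_nat _ _ _ i.+1) //= -[LHS]addr0; congr (_ + _).
    by apply: eq_bigr => k _; rewrite expr1n mul1r mulr_natr.
  rewrite big_nat_cond big1 // => k /andP[/andP[ltik _] _].
  by rewrite bin_small // mulr0.
under eq_big_nat => i /andP[_ lein] do rewrite (cE i lein) scaler_suml.
rewrite exchange_big /= scaler_sumr; apply: eq_big_nat => k /andP[_ lekn].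
rewrite (@big_cat_nat _ _ _ k) //=; last exact: ltnW.
rewrite [X in X + _]big_nat_cond big1 ?add0r; last first.
  by move=> i /andP[/andP[_ ltik] _]; rewrite bin_small // mulr0 scale0r.
rewrite -{1}[k]add0n big_addn subSn //.
under eq_big_nat => m /andP[_ lemn] do
  rewrite addnC -scalerA scalerAl binomp_mul_bin subnDA -mulrA scalerAr.
rewrite -mulr_sumr -scaler_sumr binompD.
have -> : 'X - k%:R%:P + (- 'X - beta%:P) = - (beta + k%:R)%:P :> {poly C}.
  by rewrite polyCD; ring.
rewrite binompC -!mul_polyC.
rewrite mulrCA -!polyCM mulrC; congr (_%:P * _).
have sqr1 m : (- 1) ^+ m * (- 1) ^+ m = 1 :> C.
  by rewrite -exprMn mulrNN mulr1 expr1n.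
rewrite -{1}(subnKC (lekn : (k <= n)%N)) exprD (exprNn w).
transitivity (((- 1) ^+ k * (- 1) ^+ k) * ((- 1) ^+ (n - k) * (- 1) ^+ (n - k)) *
  (w ^+ k * (poch (beta + k%:R) (n - k) / (n - k)`!%:R))); first by ring.
by rewrite !sqr1 !mul1r.
Qed.

Lemma size_binompX k : size (binomp ('X : {poly C}) k) = k.+1.
Proof.
rewrite /binomp size_scale ?invr_neq0 ?factf_neq0 //.
by rewrite (size_prod_XsubC _ (fun i => i%:R)) size_iota subn0.
Qed.

Lemma coef_binompX k : (binomp ('X : {poly C}) k)`_k = k`!%:R^-1.
Proof.
have /monicP := monic_prod_XsubC (index_iota 0 k) xpredT (fun i => i%:R : C).
rewrite /lead_coef (size_prod_XsubC _ (fun i => i%:R)) size_iota subn0 /=.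
by rewrite /binomp coefZ => ->; rewrite mulr1.
Qed.

Lemma horner_binompX k x : (binomp 'X k).[x] = (- 1) ^+ k * poch (- x) k / k`!%:R.
Proof.
rewrite /binomp hornerZ horner_prod mulrC; congr (_ / _).
rewrite /poch -[k in _ ^+ k]subn0 -prodr_const_nat -big_split /=.
by apply: eq_bigr => i _; rewrite !hornerE; ring.
Qed.

Lemma size_meixner_leq beta c n : c != 0 -> (size (meixner beta c n) <= n.+1)%N.
Proof.
move=> c0; rewrite meixnerE // (leq_trans (size_scale_leq _ _)) // big_mkord.
apply: (leq_trans (size_sum _ _ _)); apply/bigmax_leqP => k _.
by rewrite (leq_trans (size_scale_leq _ _)) // size_binompX.
Qed.

Lemma coef_meixner beta c n : c != 0 -> c != 1 -> (meixner beta c n)`_n = 1.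
Proof.
move=> c0 c1; rewrite meixnerE // coefZ coef_sum big_nat_recr //=.
rewrite big_nat_cond big1 ?add0r; last first.
  move=> k /andP[/andP[_ ltkn] _].
  by rewrite coefZ nth_default ?mulr0 // size_binompX.
rewrite coefZ coef_binompX subnn poch0 fact0 divr1 mulr1.
have c10 : c - 1 != 0 by rewrite subr_eq0.
have -> : 1 - c^-1 = (c - 1) / c by field.
rewrite expr_div_n; field.
by rewrite factf_neq0 !expf_neq0.
Qed.

Lemma size_meixner beta c n :
  c != 0 -> c != 1 -> size (meixner beta c n) = n.+1.
Proof.
move=> c0 c1; apply/eqP; rewrite eqn_leq size_meixner_leq //= ltnNge.
apply/negP => /leq_sizeP /(_ n (leqnn n)) /eqP.
by rewrite coef_meixner // oner_eq0.
Qed.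

Lemma meixner_monic beta c n : c != 0 -> c != 1 -> meixner beta c n \is monic.
Proof.
by move=> c0 c1; rewrite monicE /lead_coef size_meixner // coef_meixner.
Qed.

Lemma meixner_hypergeometric beta c n x :
  c != 0 -> (forall k, poch beta k != 0) ->
  (meixner beta c n).[x] =
  poch beta n * (c / (c - 1)) ^+ n *
    pFq [:: - n%:R; - x] [:: beta] (1 - c^-1).
Proof.
move=> c0 beta0; rewrite (@pFq_terminating _ _ _ _ n n.+1) ?mem_head //.
rewrite meixnerE // hornerZ horner_sum !mulr_sumr.
apply: eq_big_nat => k /andP[_ lekn].
rewrite hornerZ horner_binompX /pFq_term !big_cons !big_nil !mulr1.
have := poch_oppn C (lekn : (k <= n)%N).
have -> : poch beta n = poch beta k * poch (beta + k%:R) (n - k).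
  by rewrite -pochD subnKC.
rewrite expr_div_n => E.
have f0 := factf_neq0; have bk0 := beta0 k.
transitivity (c ^+ n / (c - 1) ^+ n * (1 - c^-1) ^+ k *
  (poch (beta + k%:R) (n - k) / (n - k)`!%:R) * poch (- x) k / k`!%:R *
  ((- 1) ^+ k * n`!%:R)); first by ring.
rewrite -E; move: (_ / (c - 1) ^+ n) => q.
by field; rewrite bk0 !f0.
Qed.

Lemma meixner_norm2_neq0 beta c n :
  c != 0 -> poch beta n != 0 -> meixner_norm2 beta c n != 0.
Proof.
move=> c0 b0; rewrite /meixner_norm2 mulf_neq0 ?invr_neq0 //.
  by rewrite !mulf_neq0 ?factf_neq0 ?expf_neq0.
rewrite /cpow /cexp; set z := _ * clog _; rewrite eq_complex /=.
rewrite !mulf_eq0 (gt_eqF (expR_gt0 _)) /=.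
apply/negP => /andP[/eqP cz /eqP sz]; have := cos2Dsin2 (complex.Im z).
by rewrite cz sz expr0n addr0 => /eqP; rewrite eq_sym oner_eq0.
Qed.

End MeixnerPolynomials.

(** * The Sobolev-type polynomials *)

Section Sobolev.
Variables (R : realType) (beta c : R[i]) (u : {scalar {poly R[i]}}).
Hypotheses (c_neq0 : c != 0) (c_neq1 : c != 1).
Hypothesis beta_poch : forall k, poch beta k != 0.
Hypothesis u_meixner : meixner_functional beta c u.
Local Notation C := R[i].
Local Notation M := (meixner beta c).
Local Notation d := (meixner_norm2 beta c).
Implicit Types (x alpha lambda : C) (p : {poly C}) (S : nat -> {poly C}).

Let Mm n : M n \is monic. Proof. exact: meixner_monic. Qed.
Let sM n : size (M n) = n.+1. Proof. exact: size_meixner. Qed.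
Let d0 n : d n != 0. Proof. exact: meixner_norm2_neq0. Qed.

Lemma sobolev_form_linear lambda alpha j l f a p q :
  sobolev_form u lambda alpha j l f (a *: p + q) =
  a * sobolev_form u lambda alpha j l f p + sobolev_form u lambda alpha j l f q.
Proof.
rewrite /sobolev_form Tpow_linear mulrDr linearD /= -scalerAr linearZ /=; ring.
Qed.

(** [S n] is orthogonal to every [M k] with [k < n]; this gives the
    coefficients of [S n - M n] in the Meixner basis, and hence [S n] in terms
    of its own iterated difference at [alpha]. *)
Lemma sobolev_kernel lambda alpha j l S n :
  monic_orthogonal (sobolev_form u lambda alpha j l) S ->
  S n = M n - (lambda * Tpow l j (S n) alpha) *:
    \sum_(0 <= k < n) (Tpow l j (M k) alpha / d k) *: M k.
Proof.
move=> [Smon Ssz Sorth].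
have low p : (size p <= n)%N -> sobolev_form u lambda alpha j l (S n) p = 0.
  apply: (@graded_basis_eq0 _ S Smon Ssz C^o (sobolev_form u lambda alpha j l (S n))).
    exact: sobolev_form_linear.
  by move=> k ltkn; apply: Sorth; rewrite gtn_eqF.
have sSM : (size (S n - M n)%R <= n)%N by apply: size_sub_monic.
apply/eqP; rewrite addrC -subr_eq; apply/eqP.
rewrite (orthogonal_expansion Mm sM d0 u_meixner sSM) -(scaleNr (lambda * _)) scaler_sumr.
apply: eq_big_nat => k /andP[_ ltkn]; rewrite [RHS]scalerA; congr (_ *: _).
rewrite mulrBl linearB /= u_meixner gtn_eqF // subr0.
have /eqP : sobolev_form u lambda alpha j l (S n) (M k) = 0.
  by apply: low; rewrite sM.
rewrite /sobolev_form addr_eq0 => /eqP ->; ring.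
Qed.

(** The connection formula, from the Christoffel-Darboux identity divided by
    [x - y] and differenced [j] times in [y]. *)
Lemma sobolev_connection lambda alpha j l S n x :
  monic_orthogonal (sobolev_form u lambda alpha j l) S ->
  1 + lambda * kernel_jj beta c alpha j l n.+1 != 0 ->
  (forall k, (k <= j)%N -> pi_fac alpha j l k x != 0) ->
  (S n.+1).[x] = A1 beta c alpha lambda j l n.+1 x * (M n.+1).[x] +
                 B1 beta c alpha lambda j l n.+1 x * (M n).[x].
Proof.
move=> HS K0 pi0; have SE := sobolev_kernel n.+1 HS.
set T := Tpow l j (S n.+1) alpha in SE.
(* differencing the kernel formula determines the unknown T *)
have TE : T = Tpow l j (M n.+1) alpha / (1 + lambda * kernel_jj beta c alpha j l n.+1).
  apply: (canRL (mulfK K0)).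
  have : T = Tpow l j (- (lambda * T) *:
     (\sum_(0 <= k < n.+1) (Tpow l j (M k) alpha / d k) *: M k) + M n.+1) alpha.
    by rewrite {1}/T SE addrC scaleNr.
  rewrite Tpow_linear Tpow_sum.
  have -> : \sum_(0 <= k < n.+1) Tpow l j (M k) alpha / d k * Tpow l j (M k) alpha
            = kernel_jj beta c alpha j l n.+1.
    by apply: eq_bigr => k _; rewrite expr2 mulrAC.
  move: (kernel_jj _ _ _ _ _ _) (Tpow l j (M n.+1) alpha) => K t E.
  by rewrite mulrDr mulr1 {1}E; ring.
have HK : (\sum_(0 <= k < n.+1) (Tpow l j (M k) alpha / d k) *: M k).[x] =
          Tpow l j (kernel M d n.+1 x) alpha.
  rewrite /kernel Tpow_sum horner_sum; apply: eq_bigr => k _.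
  by rewrite hornerZ; ring.
rewrite {1}SE hornerD hornerN [X in _ - X]hornerZ HK TE.
rewrite (Tpow_div_linear (Christoffel_Darboux Mm sM d0 u_meixner n x) pi0).
pose Q (m : nat) := \sum_(0 <= k < j.+1)
  Tpow l k (M m) alpha / (k`!%:R * pi_fac alpha j l k x).
set sm := \sum_(0 <= k < j.+1) _.
have -> : sm = (d n)^-1 * ((M n.+1).[x] * Q n - (M n).[x] * Q n.+1).
  rewrite /sm /Q !mulr_sumr -sumrB mulr_sumr; apply: eq_bigr => k _.
  rewrite -[_ *: (_ - _)]addr0 Tpow_linear -scaleNr Tpow_linear.
  by rewrite -[_ *: M n.+1]addr0 Tpow_linear Tpow_zero; ring.
rewrite /A1 /B1 /kappa -/(Q n) -/(Q n.+1) /=; ring.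
Qed.

End Sobolev.

Theorem theorem3p1 (R : realType) (beta c : R[i]) (lambda alpha : R)
    (j l n : nat) (u : {scalar {poly R[i]}}) (S : nat -> {poly R[i]}) (x : R[i])
    (c_neq0 : c != 0) (c_neq1 : c != 1)
    (beta_not_negint : forall k : nat, beta != - k.+1%:R)
    (lambda_ge0 : 0 <= lambda) (alpha_le0 : alpha <= 0)
    (j_ge1 : (1 <= j)%N) (n_ge1 : (1 <= n)%N)
    (l_12 : l = 1%N \/ l = 2%N)
    (u_meixner : meixner_functional beta c u)
    (S_sobolev :
       monic_orthogonal (sobolev_form u lambda%:C alpha%:C j l) S)
    (kappa_def : 1 + lambda%:C * kernel_jj beta c alpha%:C j l n != 0)
    (pi_def : forall k : nat, (k <= j)%N -> pi_fac alpha%:C j l k x != 0)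
    (B_neq0 : B1 beta c alpha%:C lambda%:C j l n x != 0)
    (pFq_def :
       pFq_defined [:: beta; - f_coef beta c alpha%:C lambda%:C j l n x - 1]) :
  (S n).[x] =
    - (poch beta n.-1 * c ^+ n.-1 / (c - 1) ^+ n.-1 *
       h_coef beta c alpha%:C lambda%:C j l n x *
       pFq [:: - n%:R; - x; - f_coef beta c alpha%:C lambda%:C j l n x]
           [:: beta; - f_coef beta c alpha%:C lambda%:C j l n x - 1]
           (1 - c^-1)).
Proof.
have beta0 k : poch beta k != 0 by apply: pFq_def; rewrite mem_head.
have f0 k : poch (- f_coef beta c alpha%:C lambda%:C j l n x - 1) k != 0.
  by apply: pFq_def; rewrite in_cons mem_head orbT.
case: n n_ge1 kappa_def B_neq0 pFq_def f0 => // m _ K0 B0 _ f0.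
rewrite (sobolev_connection c_neq0 c_neq1 beta0 u_meixner S_sobolev K0 pi_def).
rewrite !meixner_hypergeometric //.
rewrite (@pFq_terminating _ [:: - m.+1%:R; - x] _ _ m.+1 m.+2) ?mem_head //.
rewrite (@pFq_terminating _ [:: - m%:R; - x] _ _ m m.+2) ?mem_head //.
rewrite (@pFq_terminating _ [:: - m.+1%:R; _; _] _ _ m.+1 m.+2) ?mem_head //.
move: B0 f0; rewrite /h_coef /f_coef.
move: (A1 _ _ _ _ _ _ _ _) (B1 _ _ _ _ _ _ _ _) => A B B0.
set F := _ - _ - _ / _ => f0.
have N0 : (m.+1%:R : R[i]) != 0 by rewrite pnatr_eq0.
have c10 : c - 1 != 0 by rewrite subr_eq0.
have c01 : 1 - c != 0 by rewrite subr_eq0 eq_sym.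
have F10 : - F - 1 != 0 by have := f0 1%N; rewrite pochSr poch0 mul1r addr0.
(* the affine factor F + 1 - k is the combined coefficient of the k-th terms *)
have FE : F + 1 = m.+1%:R * (1 + (beta + m%:R) * (c / (c - 1)) * A / B).
  by rewrite /F -natr1; field; rewrite B0 c10.
have -> : c * (beta + m.+1%:R - 1) / (1 - c) * A - B = - (B / m.+1%:R * (F + 1)).
  by rewrite FE -natr1; field; rewrite B0 c10 natr1 N0.
rewrite /= !mulr_sumr -big_split -sumrN /=; apply: eq_bigr => k _.
rewrite /pFq_term !big_cons !big_nil !mulr1.
have PN : poch (- m%:R : R[i]) k = poch (- m.+1%:R) k * (m.+1%:R - k%:R) / m.+1%:R.
  have := poch_shift (- m.+1%:R : R[i]) k.
  rewrite (_ : - m.+1%:R + 1 = - m%:R); last by rewrite -natr1; ring.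
  by move=> E; apply: (mulIf N0); rewrite divfK // -[LHS]opprK -mulrN mulrC E; ring.
have PF : poch (- F) k = poch (- F - 1) k * (- F - 1 + k%:R) / (- F - 1).
  by apply: (mulIf F10); rewrite divfK // mulrC -poch_shift subrK.
rewrite PN PF pochSr exprS -[poch beta m * _ ^+ m / _]mulrA -expr_div_n.
have bk0 := beta0 k; have fk0 := f0 k.
clearbody F; move: (poch _ k) (poch (- x) k) (_ / k`!%:R) (poch beta m) (_ ^+ m).
move=> P X Z b q.
transitivity (b * q * (P * X / poch beta k * Z) * (B / m.+1%:R * (F + 1 - k%:R))).
  by rewrite FE -natr1 in N0 *; field; rewrite bk0 B0 c10 ?N0 -?natr1.
by field; rewrite fk0 bk0 F10 (addrC 1) natr1.
Qed.
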